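(* Let $m\in\mathbb{N}$ and let $A_1,\dots,A_n,B_1,\dots,B_n\subseteq[m]$ satisfy $A_i\cap B_i=\varnothing$ for every $i\in[n]$. Suppose $n>(m+1)\binom{m}{\lfloor m/2\rfloor}$ and set $k := n-(m+1)\binom{m}{\lfloor m/2\rfloor}$. Then for every $q\in[n]$, $$\Pr_{Q\leftarrow\binom{[n]}{q}}\big[\exists i\in Q\ \ \exists j\in[n]\setminus Q,\ i<j:\ A_i\cap B_j\subseteq B_i\big]\ \ge\ 1-\prod_{i=0}^{k}\frac{n-q-i}{n-i}-\frac{q}{n}\ \ge\ 1-\exp\!\Big(-\frac{q(k+1)}{n}\Big)-\frac{q}{n}.$$
   Context: $[n]=\{1,\dots,n\}$, $\binom{[n]}{q}$ is the set of subsets of $[n]$ of size $q$, and $Q\leftarrow\binom{[n]}{q}$ means that $Q$ is uniformly distributed on $\binom{[n]}{q}$. *)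

(* Defs.v *)
From mathcomp Require Import all_boot all_order all_algebra.
From mathcomp Require Import reals.

Set Implicit Arguments.
Unset Strict Implicit.
Unset Printing Implicit Defensive.

Import Order.TTheory GRing.Theory Num.Theory.

Local Open Scope ring_scope.

(* Indices and ground elements are 0-based: [n] is 'I_n and [m] is 'I_m. *)

Definition qsubsets (n q : nat) : {set {set 'I_n}} :=
  [set Q : {set 'I_n} | #|Q| == q].

(* Probability of the event E under the uniform distribution on S; only
   meaningful when S is nonempty (it is 0 on the empty set, as x / 0 = 0). *)
Definition unif_pr (R : realType) (T : finType) (S : {set T}) (E : pred T) : R :=
  #|[set x in S | E x]|%:R / #|S|%:R.

(* Main.v *)
Require Import Defs.
From mathcomp Require Import all_boot all_order all_algebra.
From mathcomp Require Import reals sequences exp.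
From mathcomp Require Import zify.

(* Call Q closed if no i in Q and j outside Q satisfy i < j and A_i :&: B_j
   \subset B_i; closedness is the complement of the event. Since A_i and B_i are
   disjoint, A_i = A_j with i < j forces A_i :&: B_j = set0, so every set of more
   than N = (m+1) 'C(m, m/2) >= 2^m indices contains such a pair. Given such a
   pair (v, w), a closed set either avoids v, and is then closed in the index set
   without v, or contains both v and w. By induction on the size of the index set,
   at most 'C(n-1, q-1) + 'C(N-1, q) sets of size q are closed; dividing by
   'C(n, q) gives q/n plus the product. *)

Set Implicit Arguments.
Unset Strict Implicit.
Unset Printing Implicit Defensive.

Import Order.TTheory GRing.Theory Num.Theory.

Local Open Scope ring_scope.

Lemma leq_bin_succ (m i : nat) :
  (i.+1.*2 <= m.+1)%N -> ('C(m, i) <= 'C(m, i.+1))%N.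
Proof.
move=> le_im; rewrite -(leq_pmul2l (ltn0Sn i)) mul_bin_left leq_mul2r.
by apply/orP; right; lia.
Qed.

(** Binomials increase up to the middle; the upper half follows by the symmetry of [i] and
    [m - i]. *)
Lemma leq_bin_half (m i : nat) : ('C(m, i) <= 'C(m, m %/ 2))%N.
Proof.
have below j : (j <= m./2)%N -> ('C(m, j) <= 'C(m, m./2))%N.
  move=> le_j; rewrite -(subnKC le_j).
  have: (j + (m./2 - j) <= m./2)%N by rewrite subnKC.
  elim: (_ - _)%N => [|d IHd]; first by rewrite addn0.
  rewrite addnS => lt_jd; apply: leq_trans (IHd (ltnW lt_jd)) (leq_bin_succ _).
  by lia.
rewrite divn2; have [/below//|lt_i] := leqP i m./2.
have [le_im|lt_mi] := leqP i m; last by rewrite bin_small.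
rewrite -bin_sub //; apply: below.
by lia.
Qed.

Lemma leq_exp2_bin_half (m : nat) : (2 ^ m <= m.+1 * 'C(m, m %/ 2))%N.
Proof.
have -> : (2 ^ m = \sum_(i < m.+1) 'C(m, i))%N.
  by rewrite -[2%N]/(1 + 1)%N expnDn; apply: eq_bigr => i _; rewrite !exp1n !muln1.
rewrite -[X in (_ <= X * _)%N]card_ord -sum_nat_const.
by apply: leq_sum => i _; exact: leq_bin_half.
Qed.

(** The index set [V] is a parameter so that the induction can delete indices. *)
Definition closed_in (T : finType) (e : rel T) (V Q : {set T}) : bool :=
  [forall i in Q, forall j in V :\: Q, ~~ e i j].

Lemma closed_inP (T : finType) (e : rel T) (V Q : {set T}) :
  reflect (forall i j, i \in Q -> j \in V -> j \notin Q -> ~~ e i j)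
    (closed_in e V Q).
Proof.
apply: (iffP forall_inP) => [cl i j Qi Vj Qj|cl i Qi].
  by have /forall_inP := cl i Qi; apply; rewrite inE Qj.
by apply/forall_inP => j /setDP[Vj Qj]; exact: cl.
Qed.

Lemma card_closed_in (T : finType) (e : rel T) (N q : nat) (V : {set T}) :
  (0 < N <= #|V|)%N ->
  (forall W : {set T}, (N < #|W|)%N ->
     exists i j, [/\ i \in W, j \in W, i != j & e i j]) ->
  (#|[set Q : {set T} | [&& Q \subset V, #|Q| == q.+1 & closed_in e V Q]]|
     <= 'C(#|V|.-1, q) + 'C(N.-1, q.+1))%N.
Proof.
case/andP=> N_gt0 le_NV edge.
move: le_NV; have [s] := ubnP #|V|; elim: s => // s IHs in V *.
rewrite ltnS => le_Vs; rewrite leq_eqVlt => /predU1P[NV|lt_NV].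
  (* For [#|V| = N], Pascal's rule makes the bound the number of all subsets of [V] of size
     [q.+1]. *)
  have -> : ('C(#|V|.-1, q) + 'C(N.-1, q.+1) = 'C(#|V|, q.+1))%N.
    by rewrite -NV -{3}(prednK N_gt0) binS addnC.
  rewrite -cards_draws; apply/subset_leq_card/subsetP => Q.
  by rewrite !inE => /and3P[-> ->].
have [v [w [Vv Vw ne_vw e_vw]]] := edge V lt_NV.
have cardV : #|V| = #|V :\ v|.+1 by rewrite (cardsD1 v V) Vv.
have Vw' : w \in V :\ v by rewrite in_setD1 eq_sym ne_vw.
have cardV' : #|V :\ v| = #|V :\ v :\ w|.+1 by rewrite (cardsD1 w (V :\ v)) Vw'.
have le_NV' : (N <= #|V :\ v|)%N by rewrite -ltnS -cardV.
have lt_V's : (#|V :\ v| < s)%N by rewrite -cardV.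
have := IHs _ lt_V's le_NV'.
set F := [set Q | _]; set F' := [set Q | _] => le_F'.
pose G := [set Q : {set T} | [&& Q \subset V, #|Q| == q.+1, v \in Q & w \in Q]].
have sFG : F' \subset F :|: G.
  apply/subsetP => Q; rewrite !inE => /and3P[sQV cQ /closed_inP clQ].
  rewrite sQV cQ subsetD1 sQV /=; have [Qv|Qv] /= := boolP (v \in Q).
    (* A closed set with [v] but without [w] would contradict [e v w]. *)
    by apply: contraLR e_vw => Qw; exact: clQ.
  rewrite orbF; apply/closed_inP => i j Qi /setD1P[_ Vj]; exact: clQ.
apply: leq_trans (subset_leq_card sFG) _.
apply: leq_trans (leq_card_setU _ _) _.
(* Deleting [v] lowers only the first binomial of the bound; by Pascal's rule the loss is the number
   of ways to complete [v] and [w] to a set in [G]. *)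
suff le_G : (#|G| + 'C(#|V :\ v|.-1, q) <= 'C(#|V|.-1, q))%N.
  apply: leq_trans (leq_add le_F' (leqnn _)) _.
  by rewrite addnC addnA leq_add2r.
rewrite cardV /= cardV' /=.
(* For [q = 0] the sets are singletons and cannot contain both [v] and [w], so [G] is empty. *)
case: q @G {IHs F F' le_F' sFG} => [|q] G.
  rewrite !bin0 addn1 ltnS leqn0 cards_eq0; apply/eqP/setP => Q; rewrite !inE.
  apply/negP => /and4P[_ /cards1P[x ->]]; rewrite !inE => /eqP vx /eqP wx.
  by rewrite vx wx eqxx in ne_vw.
rewrite binS addnC leq_add2l -cards_draws.
apply: leq_trans (leq_imset_card (fun Q => v |: (w |: Q)) _).
apply/subset_leq_card/subsetP => Q; rewrite inE => /and4P[sQV /eqP cQ Qv Qw].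
have Qw' : w \in Q :\ v by rewrite in_setD1 eq_sym ne_vw.
apply/imsetP; exists (Q :\ v :\ w); last by rewrite !setD1K.
rewrite inE !setSD //=.
by move: cQ; rewrite (cardsD1 v) Qv (cardsD1 w (Q :\ v)) Qw' !add1n => -[->].
Qed.

Lemma set_pair_edge (m n : nat) (A B : 'I_n -> {set 'I_m}) (W : {set 'I_n}) :
  (forall i, A i :&: B i = set0) -> (m.+1 * 'C(m, m %/ 2) < #|W|)%N ->
  exists i j : 'I_n, [/\ i \in W, j \in W, i != j &
    (i < j)%N && (A i :&: B j \subset B i)].
Proof.
move=> AB0 lt_W.
have /dinjectivePn[i Wi [j /andP[ne_ji Wj] eqA]] : ~~ dinjectiveb A W.
  apply: contraL lt_W => /dinjectiveP/card_in_imset <-; rewrite -leqNgt.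
  apply: leq_trans (leq_exp2_bin_half m).
  rewrite -[m in (2 ^ m)%N]card_ord -cardsT -card_powerset.
  by apply/subset_leq_card/subsetP => C _; rewrite powersetE subsetT.
(* The pigeonhole pair comes unordered, so the inclusion is proved both ways. *)
have ABij : A i :&: B j \subset B i by rewrite eqA AB0 sub0set.
have ABji : A j :&: B i \subset B j by rewrite -eqA AB0 sub0set.
have [lt_ij|lt_ji|/val_inj eq_ij] := ltngtP i j.
- by exists i, j; rewrite eq_sym lt_ij ABij; split.
- by exists j, i; rewrite lt_ji ABji; split.
by rewrite /= eq_ij eqxx in ne_ji.
Qed.

(** The product telescopes, each factor being a ratio of consecutive binomials ['C(n - i.+1, q)] and
    ['C(n - i, q)] while the latter is nonzero. *)
Lemma prod_bin_ratio (R : numFieldType) (n q t : nat) : (t <= n)%N -> (q <= n)%N ->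
  \prod_(0 <= i < t) ((n%:R - q%:R - i%:R) / (n%:R - i%:R)) =
  'C(n - t, q)%:R / 'C(n, q)%:R :> R.
Proof.
move=> le_tn le_qn; elim: t le_tn => [|t IHt] lt_tn.
  by rewrite big_nil subn0 divff // pnatr_eq0 -lt0n bin_gt0.
rewrite big_nat_recr //= IHt ?(ltnW lt_tn) // mulrAC; congr (_ / _).
have nt_gt0 : (0 < n - t)%N by rewrite subn_gt0.
have nt_neq0 : (n - t)%:R != 0 :> R by rewrite pnatr_eq0 -lt0n.
have -> : n%:R - t%:R = (n - t)%:R :> R by rewrite natrB // ltnW.
rewrite mulrA; apply: (mulIf nt_neq0); rewrite divfK //.
rewrite [RHS]mulrC -natrM subnS mul_bin_down natrM [RHS]mulrC.
(* If [q > n - t], the natural difference [n - t - q] is truncated, but ['C(n - t, q)] vanishes on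
   both sides. *)
have [le_q|lt_q] := leqP q (n - t); last by rewrite bin_small // !mul0r.
by rewrite natrB // natrB 1?ltnW // addrAC.
Qed.

(** Each factor is [1 - q / (n - i) <= 1 - q / n <= expR (- (q / n))]. Comparing factors requires
    them nonnegative; if [q > n - t] some may be negative, but then the product is 0. *)
Lemma prod_ratio_le_expR (R : realType) (n q t : nat) : (t <= n)%N -> (q <= n)%N ->
  \prod_(0 <= i < t) ((n%:R - q%:R - i%:R) / (n%:R - i%:R))
    <= expR (- (q%:R * t%:R / n%:R)) :> R.
Proof.
move=> le_tn le_qn; have [le_q|lt_q] := leqP q (n - t); last first.
  by rewrite prod_bin_ratio // bin_small // mul0r expR_ge0.
have -> : - (q%:R * t%:R / n%:R) = t%:R * - (q%:R / n%:R) :> R.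
  by rewrite mulrN mulrA (mulrC q%:R).
rewrite expRM_natl -[X in _ ^+ X]subn0 -prodr_const_nat.
rewrite big_nat [leRHS]big_nat; apply: ler_prod => i /andP[_ lt_it].
have lt_in : (i < n)%N := leq_trans lt_it le_tn.
have n_gt0 : 0 < n%:R :> R by rewrite ltr0n (leq_trans _ lt_in).
have ni_gt0 : 0 < n%:R - i%:R :> R by rewrite subr_gt0 ltr_nat.
have num_ge0 : 0 <= n%:R - q%:R - i%:R :> R.
  rewrite -addrA -opprD subr_ge0 -natrD ler_nat.
  by rewrite (leq_trans (leq_add le_q (ltnW lt_it))) // subnK.
rewrite divr_ge0 ?(ltW ni_gt0) //=.
apply: le_trans (expR_ge1Dx _).
rewrite addrAC mulrBl divff ?gt_eqF // lerD2l lerN2.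
by rewrite ler_wpM2l // lef_pV2 ?posrE // gerBl.
Qed.

Theorem corollary6p2 (R : realType) (m n : nat)
    (A B : 'I_n -> {set 'I_m})
    (AB0 : forall i : 'I_n, A i :&: B i = set0)
    (n_large : (m.+1 * 'C(m, m %/ 2) < n)%N) :
  let k := (n - m.+1 * 'C(m, m %/ 2))%N in
  forall q : nat, (1 <= q <= n)%N ->
    let pr : R := unif_pr R (qsubsets n q)
      (fun Q : {set 'I_n} =>
         [exists i in Q, exists j in ~: Q,
            (i < j)%N && (A i :&: B j \subset B i)]) in
    let bound : R :=
      1 - \prod_(0 <= i < k.+1) ((n%:R - q%:R - i%:R) / (n%:R - i%:R))
        - q%:R / n%:R in
    pr >= bound /\
    bound >= 1 - expR (- (q%:R * (k + 1)%:R / n%:R)) - q%:R / n%:R.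
Proof.
set N := (m.+1 * 'C(m, m %/ 2))%N => k q /andP[q_gt0 le_qn] pr bound.
have N_gt0 : (0 < N)%N by rewrite muln_gt0 bin_gt0 leq_div.
have le_kn : (k.+1 <= n)%N by rewrite /k; lia.
split; last by rewrite lerD2r lerD2l lerN2 addn1 prod_ratio_le_expR.
pose e : rel 'I_n := fun i j => (i < j)%N && (A i :&: B j \subset B i).
pose F := [set Q : {set 'I_n} | [&& Q \subset setT, #|Q| == q & closed_in e setT Q]].
have leF : (#|F| <= 'C(n.-1, q.-1) + 'C(n - k.+1, q))%N.
  have -> : (n - k.+1 = N.-1)%N by rewrite /k; lia.
  rewrite /F -(prednK q_gt0) /=.
  have := @card_closed_in _ e N q.-1 setT; rewrite cardsT card_ord.
  by apply=> [|W]; [rewrite N_gt0 ltnW|exact: set_pair_edge].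
have Cnq_gt0 : 0 < 'C(n, q)%:R :> R by rewrite ltr0n bin_gt0.
have n_gt0 : (0 < n)%N by apply: leq_trans le_kn.
have card_q : #|qsubsets n q| = 'C(n, q).
  by rewrite /qsubsets card_draws card_ord.
have -> : pr = 1 - #|F|%:R / 'C(n, q)%:R.
  rewrite /pr /unif_pr card_q; apply: (mulIf (lt0r_neq0 Cnq_gt0)).
  rewrite mulrBl mul1r !divfK ?lt0r_neq0 //.
  apply/eqP; rewrite eq_sym subr_eq -natrD eqr_nat -card_q.
  (* Among the [q]-subsets, those outside [F] are exactly the event. *)
  rewrite -(cardsID F (qsubsets n q)) addnC; apply/eqP; congr (_ + _)%N; apply/eq_card => Q.
    rewrite !inE subsetT /=; case: (#|Q| == q) => //=; rewrite ?andbF // andbT.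
    rewrite /closed_in negb_forall_in; apply: eq_existsb => i.
    rewrite negb_forall_in; congr (_ && _); apply: eq_existsb => j.
    by rewrite negbK !inE andbT.
  by rewrite !inE subsetT /=; case: (#|Q| == q).
rewrite /bound prod_bin_ratio // -addrA lerD2l -opprD lerN2.
(* This is the absorption identity [n * 'C(n.-1, q.-1) = q * 'C(n, q)]. *)
have -> : q%:R / n%:R = 'C(n.-1, q.-1)%:R / 'C(n, q)%:R :> R.
  apply/eqP; rewrite eqr_div ?pnatr_eq0 -?lt0n ?bin_gt0 //.
  rewrite -!natrM eqr_nat; have := mul_bin_diag n q.-1.
  by rewrite prednK // => <-; rewrite mulnC.
by rewrite -mulrDl ler_pM2r ?invr_gt0 // -natrD ler_nat addnC.
Qed.
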